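(* For all integers $m \ge n \ge 2$, the complete bipartite graph $K_{m,n}$ satisfies $\mathrm{gp}(S(K_{m,n})) = 2m$.
   Context: The shadow graph $S(G)$ of a graph $G$ is obtained from $G$ by adding, for each vertex $v$ of $G$, a new vertex $v'$ (the shadow vertex of $v$), and joining $v'$ to all neighbours of $v$ in $G$ (shadow vertices are pairwise non-adjacent). A set $S$ of vertices of a graph is a general position set if no three distinct vertices of $S$ lie on a common shortest path (geodesic); the general position number $\mathrm{gp}(H)$ is the maximum cardinality of a general position set of $H$. *)

(* Defs.v *)
From mathcomp Require Import all_boot.
From mathcomp Require Import boolp.

Set Implicit Arguments.
Unset Strict Implicit.
Unset Printing Implicit Defensive.

Record sgraph := SGraph {
  vertex :> finType;
  adj : rel vertex;
  adj_sym : symmetric adj;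
  adj_irr : irreflexive adj }.

Arguments adj {s}.

(* In S(G), [inl v] is the original vertex v and [inr v] its shadow v'. *)
Section Shadow.
Variable G : sgraph.

Definition shadow_adj (a b : G + G) : bool :=
  match a, b with
  | inl u, inl v | inl u, inr v | inr u, inl v => adj u v
  | inr _, inr _ => false
  end.

Lemma shadow_adj_sym : symmetric shadow_adj.
Proof. by move=> [u|u] [v|v] //=; rewrite adj_sym. Qed.

Lemma shadow_adj_irr : irreflexive shadow_adj.
Proof. by move=> [u|u] //=; rewrite adj_irr. Qed.

Definition shadow : sgraph := SGraph shadow_adj_sym shadow_adj_irr.

End Shadow.

Section CompleteBipartite.
Variables m n : nat.

Definition complete_bipartite_adj (a b : 'I_m + 'I_n) : bool :=
  match a, b with
  | inl _, inr _ | inr _, inl _ => true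
  | _, _ => false
  end.

Lemma complete_bipartite_adj_sym : symmetric complete_bipartite_adj.
Proof. by move=> [u|u] [v|v]. Qed.

Lemma complete_bipartite_adj_irr : irreflexive complete_bipartite_adj.
Proof. by move=> [u|u]. Qed.

Definition complete_bipartite : sgraph :=
  SGraph complete_bipartite_adj_sym complete_bipartite_adj_irr.

End CompleteBipartite.

Section GeneralPosition.
Variable G : sgraph.

(* As in [path], the vertices of the walk are those of [x :: p] and its length
   is [size p]. *)
Definition geodesic (x : G) (p : seq G) : Prop :=
  path adj x p /\
  forall q : seq G, path adj x q -> last x q = last x p -> size p <= size q.

Definition general_position (S : {set G}) : Prop :=
  forall u v w : G, u \in S -> v \in S -> w \in S ->
    u != v -> v != w -> u != w ->
    ~ exists (x : G) (p : seq G),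
        [/\ geodesic x p, u \in x :: p, v \in x :: p & w \in x :: p].

Definition gp : nat := \max_(S : {set G} | `[< general_position S >]) #|S|.

End GeneralPosition.

(* Main.v *)
Require Import Defs.
From mathcomp Require Import all_boot.
From mathcomp Require Import boolp zify.

(** Let A, B be the parts of K_{m,n} and A', B' their shadows. The shadow graph
    is bipartite with parts A + A' and B + B', two vertices of different parts
    being adjacent unless both are shadows. Its diameter is 3, so a geodesic
    meets a part in at most two vertices and A + A' is in general position.
    Conversely, an original vertex lies between any two vertices of the other
    part, and a, b lie on a geodesic a' b a b' for all a', b'. Hence a general
    position set meeting both parts has at most 2 elements if it meets A and B,
    at most m + 1 or n + 1 if it meets exactly one of them, and otherwise is
    contained in A' + B'. *)

Local Arguments adj : simpl never.

Section ShadowCompleteBipartite.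
Variables m n : nat.

Local Notation SK := (shadow (complete_bipartite m n)).

Definition part (v : SK) : bool :=
  match v with
  | inl (inl _) | inr (inl _) => true
  | inl (inr _) | inr (inr _) => false
  end.

Definition original (v : SK) : bool := if v is inl _ then true else false.

(** Adjacency depends on two booleans per vertex, so the distance arguments below become finite case
    checks. *)
Lemma adj_partE (u v : SK) :
  adj u v = (part u != part v) && (original u || original v).
Proof. by move: u v => [[i|i]|[i|i]] [[j|j]|[j|j]]. Qed.

Lemma card_part_original (c o : bool) :
  #|[set v : SK | (part v == c) && (original v == o)]| = if c then m else n.
Proof.
have card_range k (f : 'I_k -> SK) (P : pred SK) : injective f ->
    (forall i, P (f i)) -> (forall v, P v -> exists i, v = f i) ->
    #|[set v | P v]| = k.
  move=> f_inj Pf fP; rewrite -[RHS]card_ord -cardsT -(card_imset _ f_inj).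
  apply: eq_card => v; rewrite inE; apply/idP/imsetP => [/fP[i ->]|[i _ ->] //].
  by exists i.
case: c; case: o.
- apply: (card_range _ (fun i => inl (inl i))) => [i j []||] //.
  by case=> [[i|i]|[i|i]] //; exists i.
- apply: (card_range _ (fun i => inr (inl i))) => [i j []||] //.
  by case=> [[i|i]|[i|i]] //; exists i.
- apply: (card_range _ (fun i => inl (inr i))) => [i j []||] //.
  by case=> [[i|i]|[i|i]] //; exists i.
- apply: (card_range _ (fun i => inr (inr i))) => [i j []||] //.
  by case=> [[i|i]|[i|i]] //; exists i.
Qed.

Lemma card_part (c : bool) :
  #|[set v : SK | part v == c]| = 2 * if c then m else n.
Proof.
rewrite -(cardsID [set v | original v]) mulSn mul1n.
congr (_ + _); [rewrite -(card_part_original c true)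
               |rewrite -(card_part_original c false)].
  by apply: eq_card => v; rewrite !inE eqb_id.
by apply: eq_card => v; rewrite !inE eqbF_neg andbC.
Qed.

Lemma ex_original (c : bool) : 0 < m -> 0 < n ->
  exists2 v : SK, original v & part v = c.
Proof.
move=> m_gt0 n_gt0; case: c; first by exists (inl (inl (Ordinal m_gt0))).
by exists (inl (inr (Ordinal n_gt0))).
Qed.

Lemma geodesic_same_part (u v w : SK) :
  u != w -> part u = part w -> part v != part u -> original v ->
  geodesic u [:: v; w].
Proof.
move=> uw puw pvu ov; split=> [|[|x [|y q]]] //=.
- by rewrite !adj_partE ov -puw pvu eq_sym pvu orbT.
- by move=> _ e; rewrite e eqxx in uw.
- by rewrite andbT adj_partE => /andP[pux _] e; rewrite e puw eqxx in pux.
Qed.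

(** Two shadows are never adjacent, and a walk of length 2 returns to the part it started from, so
    shadows of different parts are at distance at least 3. *)
Lemma geodesic_shadows (u v w x : SK) :
  ~~ original u -> original v -> original w -> ~~ original x ->
  part v = part x -> part w = part u -> part u != part x ->
  geodesic u [:: v; w; x].
Proof.
move=> ou ov ow ox pv pw pux; split=> [|[|y [|z [|t q]]]] //=.
- by rewrite !adj_partE ov ow pv pw pux orbT eq_sym pux.
- by move=> _ e; rewrite e eqxx in pux.
- by rewrite andbT adj_partE => /andP[_ +] e; rewrite e (negbTE ou) (negbTE ox).
- rewrite andbT !adj_partE => /and3P[/andP[+ _] + _] e; rewrite e; move: pux.
  by case: (part u) (part x) (part y) => -[] [].
Qed.

Lemma general_position_part (c : bool) :
  0 < m -> 0 < n -> general_position [set v : SK | part v == c].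
Proof.
move=> m_gt0 n_gt0 u v w; rewrite !inE => /eqP pu /eqP pv /eqP pw.
move=> uv vw uw [x [p [[walk_p min_p] up vp wp]]].
(* Originals [y] and [z] give a walk of length 2 between the ends when these share a part, and one
   of length 3 otherwise. *)
have size_p : size p <= 3.
  have [y oy py] := ex_original (~~ part x) m_gt0 n_gt0.
  have [z oz pz] := ex_original (part x) m_gt0 n_gt0.
  have [pe|pe] := eqVneq (part x) (part (last x p)).
    suff : path adj x [:: y; last x p] by move/min_p=> /(_ erefl)/leq_trans->.
    by rewrite /= !adj_partE oy py -pe orbT; case: (part x).
  suff : path adj x [:: y; z; last x p] by move/min_p=> /(_ erefl)/leq_trans->.
  rewrite /= !adj_partE oy oz py pz orbT.
  by case: (part x) (part (last x p)) pe => -[].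
have {min_p} : uniq [:: u; v; w].
  by rewrite /= !inE negb_or uv uw vw.
have sub_part : {subset [:: u; v; w] <= [seq y <- x :: p | part y == c]}.
  by move=> y; rewrite !inE mem_filter => /or3P[] /eqP->;
    rewrite ?pu ?pv ?pw eqxx.
move=> /uniq_leq_size/(_ sub_part).
(* The parts alternate along the walk, so at most two of its at most four vertices lie in part [c],
   against three distinct ones. *)
move: walk_p size_p {up vp wp sub_part}; rewrite size_filter.
case: p => [|y [|z [|t [|? ?]]]] //=; rewrite ?adj_partE; move: c {pu pv pw};
  try case: (part y); try case: (part z); try case: (part t);
  by case: (part x) => -[] //=; rewrite ?andbF.
Qed.

Section Bound.
Variable S : {set SK}.
Hypothesis gpS : general_position S.

Lemma gp_other_part_le1 (v : SK) : v \in S -> original v ->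
  #|[set u in S | part u != part v]| <= 1.
Proof.
move=> vS ov; apply/card_le1_eqP => w u; rewrite !inE.
move=> /andP[wS pw] /andP[uS pu]; apply/eqP/negPn/negP => uw.
have puw : part u = part w by move: pu pw; do 3 case: (part _).
have uv : u != v by apply: contraNneq pu => ->.
have vw : v != w by apply: contraNneq pw => ->.
apply: (gpS _ _ _ uS vS wS uv vw uw).
exists u, [:: v; w]; split; rewrite ?inE ?eqxx ?orbT //.
by apply: geodesic_same_part; rewrite // eq_sym.
Qed.

(** The geodesic is [u], [w], [v], [x], where [w] is any original in the part of [x]; it need not
    belong to [S]. *)
Lemma gp_no_shadows_of_both (u v x : SK) : 0 < m -> 0 < n ->
  u \in S -> v \in S -> x \in S ->
  ~~ original u -> original v -> ~~ original x ->
  part v = part u -> part u != part x -> False.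
Proof.
move=> m_gt0 n_gt0 uS vS xS ou ov ox pv pux.
have [w ow pw] := ex_original (part x) m_gt0 n_gt0.
have uv : u != v by apply: contraNneq ou => ->.
have vx : v != x by apply: contraNneq ox => <-.
have ux : u != x by apply: contraNneq pux => ->.
apply: (gpS _ _ _ uS vS xS uv vx ux).
exists u, [:: w; v; x]; split; rewrite ?inE ?eqxx ?orbT //.
exact: geodesic_shadows.
Qed.

Lemma card_gp_original (v x : SK) : 0 < m -> 0 < n ->
  v \in S -> original v -> x \in S -> ~~ original x -> part x != part v ->
  #|S| <= (if part v then m else n) + 1.
Proof.
move=> m_gt0 n_gt0 vS ov xS ox pxv.
rewrite -(cardsID [set u | part u == part v]) leq_add //; last first.
  apply: leq_trans (gp_other_part_le1 _ vS ov); apply: subset_leq_card.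
  by apply/subsetP => u; rewrite !inE andbC.
rewrite -(card_part_original _ true); apply: subset_leq_card.
(* A shadow [u] in the part of [v] would lie on a common geodesic with [v] and [x], so [S] has only
   originals in this part. *)
apply/subsetP => u; rewrite !inE eqb_id => /andP[uS /eqP pu].
rewrite pu eqxx /=; apply/negPn/negP => ou.
by apply: (@gp_no_shadows_of_both u v x); rewrite // pu // eq_sym.
Qed.

(** Each of the two originals leaves room for at most one element of [S] in the opposite part. *)
Lemma card_gp_two_originals (v x : SK) :
  v \in S -> original v -> x \in S -> original x -> part x != part v ->
  #|S| <= 2.
Proof.
move=> vS ov xS ox pxv.
rewrite -(cardsID [set u | part u == part v]) -[2]/(1 + 1) leq_add //.
  apply: leq_trans (gp_other_part_le1 _ xS ox); apply: subset_leq_card.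
  apply/subsetP => u; rewrite !inE => /andP[-> /eqP->] /=.
  by rewrite eq_sym.
apply: leq_trans (gp_other_part_le1 _ vS ov); apply: subset_leq_card.
by apply/subsetP => u; rewrite !inE andbC.
Qed.

Lemma card_gp_shadows : {in S, forall v, ~~ original v} -> #|S| <= m + n.
Proof.
move=> oS; rewrite -(cardsID [set u | part u == true]) leq_add //.
  rewrite -[leqRHS](card_part_original true false); apply: subset_leq_card.
  apply/subsetP => u; rewrite !inE => /andP[/oS].
  by rewrite eqbF_neg andbC => -> ->.
rewrite -[leqRHS](card_part_original false false); apply: subset_leq_card.
apply/subsetP => u; rewrite !inE => /andP[+ /oS].
by rewrite eqb_id !eqbF_neg => -> ->.
Qed.

Lemma card_gp_le : 2 <= n -> n <= m -> #|S| <= 2 * m.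
Proof.
move=> n_ge2 nm; have [m_gt0 n_gt0] : 0 < m /\ 0 < n by lia.
have [/existsP[v /andP[vS ov]]|noS] := boolP [exists v in S, original v]; last first.
  have := card_gp_shadows; suff oS : {in S, forall v, ~~ original v}.
    by move/(_ oS); lia.
  by move=> v vS; apply: contra noS => ov; apply/existsP; exists v; rewrite vS.
have [/existsP[x /andP[xS pxv]]|one_part] :=
  boolP [exists x in S, part x != part v].
  have [ox|ox] := boolP (original x).
    by have := card_gp_two_originals _ _ vS ov xS ox pxv; lia.
  have := card_gp_original _ _ m_gt0 n_gt0 vS ov xS ox pxv.
  by case: (part v); lia.
(* Here [S] lies in a single part, of size [2 * m] or [2 * n]. *)
have : #|S| <= #|[set u : SK | part u == part v]|.
  apply/subset_leq_card/subsetP => u uS; rewrite inE.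
  by apply: contraNT one_part => pu; apply/existsP; exists u; rewrite uS.
by rewrite card_part; case: (part v); lia.
Qed.

End Bound.
End ShadowCompleteBipartite.

Theorem proposition3p3 (m n : nat) (hn : 2 <= n) (hmn : n <= m) :
  gp (shadow (complete_bipartite m n)) = 2 * m.
Proof.
apply/eqP; rewrite eqn_leq; apply/andP; split.
  by apply/bigmax_leqP => S /asboolP gpS; apply: card_gp_le.
(* The lower bound is witnessed by the part of size [2 * m], shadows included. *)
rewrite -(card_part m n true).
apply: (leq_bigmax_cond (F := fun S : {set _} => #|S|)).
by apply/asboolP/general_position_part; lia.
Qed.
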